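(* For all integers $m\ge4$ and $p\ge1$, $$\langle K_m,p\rangle=\langle K_{m-3},P(c,p)+1\rangle\cup\langle K_{m-2},P(b,p)+1\rangle\cup\langle K_{m-1},P(a,p)+1\rangle .$$
   Context: The Tribonacci sequence $\mathbb{T}$ is the infinite word over $\{a,b,c\}$ that is the fixed point beginning with $a$ of the morphism $\tau(a)=ab$, $\tau(b)=ac$, $\tau(c)=a$; positions are numbered from $1$. Put $T_{-1}=c$ and $T_m=\tau^m(a)$ for $m\ge0$, and let $\delta_m$ be the last letter of $T_m$ ($m\ge-1$). The kernel numbers are $k_0=0$, $k_1=k_2=1$, $k_m=k_{m-1}+k_{m-2}+k_{m-3}-1$ for $m\ge3$. The kernel words are $K_1=a$, $K_2=b$, $K_3=c$, and $K_m=\delta_{m-1}T_{m-3}[1,k_m-1]$ for $m\ge4$, where $\rho[i,j]$ denotes the subword of $\rho$ from position $i$ to position $j$; e.g. $K_4=aa$, $K_5=bab$. For a nonempty factor $\omega$ of $\mathbb{T}$, $Ker(\omega)$ is the maximal kernel word occurring in $\omega$, i.e. the $K_m$ of largest index $m$ that is a factor of $\omega$. For a factor $\omega$ and $p\ge1$, $P(\omega,p)$ is the position of the last letter of the $p$-th occurrence of $\omega$ in $\mathbb{T}$. $\mathcal{P}_T$ is the set of nonempty palindromes occurring as factors of $\mathbb{T}$. For $m,p\ge1$, $\langle K_m,p\rangle=\{P(\omega,p):\omega\in\mathcal{P}_T,\ Ker(\omega)=K_m\}$. *)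

(* Defs.v *)
From HB Require Import structures.
From mathcomp Require Import all_boot boolp classical_sets.

Set Implicit Arguments.
Unset Strict Implicit.
Unset Printing Implicit Defensive.

Inductive letter : Type := La | Lb | Lc.

Definition letter_eqb (x y : letter) : bool :=
  match x, y with
  | La, La | Lb, Lb | Lc, Lc => true
  | _, _ => false
  end.

Lemma letter_eqP : Equality.axiom letter_eqb.
Proof. by case; case; constructor. Qed.

HB.instance Definition _ := hasDecEq.Build letter letter_eqP.

Notation word := (seq letter).

Definition tau1 (x : letter) : word :=
  match x with
  | La => [:: La; Lb]
  | Lb => [:: La; Lc]
  | Lc => [:: La]
  end.

Definition tau (w : word) : word := flatten (map tau1 w).

(* T_m = tau^m(a), for m >= 0. The word T_{-1} = c is not needed below, since
   K_m only involves T_(m-3) and the last letter of T_(m-1) for m >= 4. *)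
Definition Tw (m : nat) : word := iter m tau [:: La].

(* The last letter of T_m; the default value La is irrelevant, as T_m is
   nonempty. *)
Definition delta (m : nat) : letter := last La (Tw m).

(* t[i, j], for an infinite word t whose positions are numbered from 1
   (t 0 is meaningless). *)
Definition subword (t : nat -> letter) (i j : nat) : word :=
  [seq t l | l <- iota i (j.+1 - i)].

(* The letter of the Tribonacci sequence at position i >= 1, read off T_i,
   which has more than i letters. [tribP] below shows that this is the
   fixed point of tau beginning with a. *)
Definition trib (i : nat) : letter := nth La (Tw i) i.-1.

Definition fixed_point_from_a (t : nat -> letter) : Prop :=
  t 1 = La /\
  forall n, tau (subword t 1 n) = subword t 1 (size (tau (subword t 1 n))).

(* k_m; the truncated subtraction is exact, since k_m >= 1 for m >= 1. *)
Fixpoint kernel_num (m : nat) : nat :=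
  match m with
  | 0 => 0
  | 1 => 1
  | 2 => 1
  | ((m0.+1 as m1).+1 as m2).+1 =>
      kernel_num m2 + kernel_num m1 + kernel_num m0 - 1
  end.

(* K_m, for m >= 1; K_0 is a junk value. *)
Definition kernel_word (m : nat) : word :=
  match m with
  | 0 => [::]
  | 1 => [:: La]
  | 2 => [:: Lb]
  | 3 => [:: Lc]
  | _ => delta (m - 1) :: take (kernel_num m - 1) (Tw (m - 3))
  end.

Definition occurs_at (w : word) (q : nat) : bool :=
  (size w <= q) && (w == subword trib (q - size w).+1 q).

Definition factor (w : word) : Prop := exists q, occurs_at w q.

Definition pth_occurrence (w : word) (p q : nat) : Prop :=
  occurs_at w q /\ count (occurs_at w) (iota 1 q) = p.

Local Open Scope classical_set_scope.

(* P(w, p). The default value 0 is never taken for p >= 1 and w a nonempty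
   factor of the Tribonacci sequence, as such a w has infinitely many
   occurrences. *)
Definition occ_end (w : word) (p : nat) : nat :=
  xget 0 [set q | pth_occurrence w p q].

(* Ker(w): K_m for the largest m >= 1 such that K_m is a factor of w. This m
   exists for nonempty w, as the letters are the words K_1, K_2, K_3; otherwise
   the value is the junk K_0. *)
Definition Ker (w : word) : word :=
  kernel_word (xget 0 [set m | [/\ 1 <= m, infix (kernel_word m) w &
    forall j, 1 <= j -> infix (kernel_word j) w -> j <= m]]).

Definition pal_factors : set word :=
  [set w | [/\ w <> [::], rev w = w & factor w]].

(* <K_m, p> *)
Definition bracket (m p : nat) : set nat :=
  [set occ_end w p | w in [set w | pal_factors w /\ Ker w = kernel_word m]].

Lemma tau_cat (u v : word) : tau (u ++ v) = tau u ++ tau v.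
Proof. by rewrite /tau map_cat flatten_cat. Qed.

Lemma Tw_prefixS (m : nat) : exists2 v, v <> [::] & Tw m.+1 = Tw m ++ v.
Proof.
elim: m => [|m [v v0 e]]; first by exists [:: Lb].
exists (tau v); first by case: v v0 {e} => [|[] v].
by rewrite -tau_cat -e.
Qed.

Lemma size_Tw (m : nat) : m < size (Tw m).
Proof.
elim: m => // m IH; have [[|x v] // _ ->] := Tw_prefixS m.
by rewrite size_cat /= addnS ltnS (leq_trans IH) ?leq_addr.
Qed.

Lemma Tw_prefix (m n : nat) : m <= n -> exists v, Tw n = Tw m ++ v.
Proof.
elim: n => [|n IH]; first by rewrite leqn0 => /eqP ->; exists [::].
rewrite leq_eqVlt ltnS => /orP[/eqP ->|/IH[v e]].
  by exists [::]; rewrite cats0.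
by have [u _ ->] := Tw_prefixS n; exists (v ++ u); rewrite e catA.
Qed.

Lemma trib_Tw (m i : nat) : i < size (Tw m) -> trib i.+1 = nth La (Tw m) i.
Proof.
rewrite /trib [i.+1.-1]/= => lt_i.
have lt_i' : i < size (Tw i.+1) by apply: leq_trans (size_Tw _).
case: (leqP m i.+1) => [/Tw_prefix|/ltnW/Tw_prefix] [v ->].
  by rewrite nth_cat lt_i.
by rewrite nth_cat lt_i'.
Qed.

Lemma subword_take (m n : nat) :
  n <= size (Tw m) -> subword trib 1 n = take n (Tw m).
Proof.
move=> le_n; rewrite /subword subn1 /=.
apply: (@eq_from_nth _ La); first by rewrite size_map size_iota size_takel.
move=> i; rewrite size_map size_iota => lt_i.
rewrite (nth_map 0) ?size_iota // nth_iota // nth_take // add1n.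
by apply: trib_Tw; apply: leq_trans le_n.
Qed.

Lemma trib_fixed_point : fixed_point_from_a trib.
Proof.
split=> // n; have le_n := ltnW (size_Tw n).
have eT : Tw n.+1 = tau (take n (Tw n)) ++ tau (drop n (Tw n)).
  by rewrite -tau_cat cat_take_drop.
rewrite (subword_take le_n) (@subword_take n.+1) eT ?take_size_cat //.
by rewrite size_cat leq_addr.
Qed.

Lemma size_subword1 (t : nat -> letter) (n : nat) : size (subword t 1 n) = n.
Proof. by rewrite size_map size_iota subn1. Qed.

Lemma take_subword1 (t : nat -> letter) (m n : nat) :
  m <= n -> take m (subword t 1 n) = subword t 1 m.
Proof. by move=> le_mn; rewrite /subword !subn1 -map_take take_iota (minn_idPl _). Qed.

Lemma fixed_point_Tw (t : nat -> letter) (m : nat) :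
  fixed_point_from_a t -> Tw m = subword t 1 (size (Tw m)).
Proof.
move=> [t1 tP]; elim: m => [|m IH]; first by rewrite /subword /= t1.
by rewrite [Tw _]/= -/(Tw m) {1 2}IH tP -tP.
Qed.

Lemma tribP (t : nat -> letter) :
  fixed_point_from_a t <-> forall i, 1 <= i -> t i = trib i.
Proof.
split=> [tP [|i] // _|eq_t].
  have lt_i : i < size (Tw i) by exact: size_Tw.
  rewrite (trib_Tw lt_i) (fixed_point_Tw i tP).
  by rewrite (nth_map 0) ?nth_iota ?size_iota ?subn1.
have eq_sub n : subword t 1 n = subword trib 1 n.
  by apply/eq_in_map => l; rewrite mem_iota => /andP[/eq_t].
have [h1 hP] := trib_fixed_point.
by split=> [|n]; rewrite ?eq_t // !eq_sub.
Qed.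

(* Main.v *)
Require Import Defs.
From mathcomp Require Import all_boot zify boolp classical_sets.
Local Open Scope classical_set_scope.

(** Put [Phi v = tau v a].  Since [a] occurs exactly at the beginning of each
    block [tau x], every factor beginning and ending with [a] is [Phi v] for a
    unique factor [v], and the [p]-th occurrence of [v], ending at [q],
    corresponds to the [p]-th occurrence of [Phi v], ending at [theta q + 1]
    with [theta q = |tau (T[1,q])|].  A palindrome [w] beginning with [b] or [c]
    is always surrounded by [a]'s, so that [a w a] is again some [Phi v].  Both
    operations preserve palindromes, and turn K_m into K_(m+1): [Phi K_m] is
    K_(m+1) if K_m begins with [c], and [a K_(m+1) a] otherwise.  Hence
    <K_(m+1), p> is the image of <K_m, p> under an operator [lift_pos] on sets
    of positions, depending neither on [m] nor on [p] and commuting with unions.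
    This reduces the theorem to [m = 4], where <K_4, p> is the third iterate of
    [lift_pos] on the singleton <K_1, p> = {P(a, p)}. *)

(** * Decoding images of the morphism *)

Definition Phi (v : word) : word := rcons (tau v) La.

Lemma tau_cons x w : tau (x :: w) = tau1 x ++ tau w.
Proof. by []. Qed.

(** Each block [tau1 x] contains exactly one [La], its first letter, so a cut just before an [La]
    falls between two blocks. *)
Lemma tau_cut w x y :
  tau w = x ++ La :: y ->
  exists w1 w2, [/\ w = w1 ++ w2, x = tau w1 & La :: y = tau w2].
Proof.
elim: w x => [|l w IH] x; first by case: x.
rewrite tau_cons; case: x => [|x0 x] e.
  by exists [::], (l :: w); rewrite tau_cons e.
suff [x' ex ew] : exists2 x', x0 :: x = tau1 l ++ x' & tau w = x' ++ La :: y.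
  have [w1 [w2 [-> ex' ey]]] := IH _ ew.
  by exists (l :: w1), w2; split=> //; rewrite ex tau_cons ex'.
case: l e => [] /= [<-]; last by move=> e; exists x.
  by case: x => [|x1 x] // [<- e]; exists x.
by case: x => [|x1 x] // [<- e]; exists x.
Qed.

Lemma tau_inj : injective tau.
Proof.
have tauE w : tau w = [::] \/ exists s, tau w = La :: s.
  by case: w => [|l w]; [left | right; case: l; eexists].
elim=> [|x v IH] [|y w] //; try by [case: x | case: y].
rewrite !tau_cons; case: x; case: y => /= e; first [by case: e => /IH-> | exfalso];
  by case: (tauE v) e => [|[s]] ->; case: (tauE w) => [|[s']] ->.
Qed.

Lemma Phi_inj : injective Phi.
Proof. by move=> u v /rcons_inj[/tau_inj]. Qed.

Lemma Phi_cons x v : Phi (x :: v) = tau1 x ++ Phi v.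
Proof. by rewrite /Phi tau_cons rcons_cat. Qed.

Lemma Phi_cat u v : Phi (u ++ v) = tau u ++ Phi v.
Proof. by rewrite /Phi tau_cat rcons_cat. Qed.

Lemma Phi_head v : exists s, Phi v = La :: s.
Proof. by case: v => [|[] v]; eexists. Qed.

(** The closing [La] restores symmetry: a block followed by [La] reads aba, aca or aa. *)
Lemma rev_Phi v : rev (Phi v) = Phi (rev v).
Proof.
elim: v => //= x v IH.
rewrite Phi_cons rev_cat IH rev_cons /Phi -[rcons (rev v) x]cats1 tau_cat.
by case: x; rewrite /= -!cats1 -!catA.
Qed.

Definition sparse := sorted (fun x y : letter => (x == La) || (y == La)).

Lemma sparse_Phi v : sparse (Phi v).
Proof.
elim: v => // x v IH; rewrite Phi_cons.
by case: x; case: (Phi_head v) IH => s -> /= ->.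
Qed.

Lemma sparse_nonA x y u v : sparse (u ++ x :: y :: v) -> x <> La -> y = La.
Proof.
rewrite /sparse sorted_cat_cons /= => /andP[_ /andP[/orP[]/eqP-> //]].
Qed.

(** * Prefixes of the Tribonacci word and positions of [La] *)

Notation pre := (subword trib 1).

Lemma preS n : pre n.+1 = rcons (pre n) (trib n.+1).
Proof.
have e : n.+2 - 1 = n + 1 by rewrite subn1 addn1.
by rewrite /subword e iotaD map_cat cats1 add1n subn1.
Qed.

Lemma occurs_atE w q : occurs_at w q = suffix w (pre q).
Proof.
rewrite /occurs_at suffixE size_subword1 /subword subSS subn1 /=.
rewrite -map_drop drop_iota addnC addn1.
case: leqP => [le_q|lt_q] /=; first by rewrite eq_sym.
apply/esym/eqP => e; move: lt_q; rewrite -e size_map size_iota.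
by rewrite ltnNge leq_subr.
Qed.

(** Blocks start with their only [La], so [(theta n).+1] is the position of the [La] numbered
    [n.+1]. *)
Definition theta n := size (tau (pre n)).

Lemma theta0 : theta 0 = 0.
Proof. by []. Qed.

Lemma tau_pre n : tau (pre n) = pre (theta n).
Proof. by have [_ ->] := trib_fixed_point. Qed.

Lemma thetaS n : theta n.+1 = theta n + size (tau1 (trib n.+1)).
Proof. by rewrite /theta preS -cats1 tau_cat size_cat /tau /= cats0. Qed.

Lemma pre_inj : injective pre.
Proof. by move=> m n /(congr1 size); rewrite !size_subword1. Qed.

Lemma pre_prefix n u v : pre n = u ++ v -> u = pre (size u).
Proof.
move=> e; have le_n : size u <= n.
  by rewrite -(size_subword1 trib n) e size_cat leq_addr.
by rewrite -(take_subword1 trib le_n) e take_size_cat.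
Qed.

Lemma pre_thetaS n : pre (theta n).+1 = Phi (pre n).
Proof.
have := tau_pre n.+1; rewrite {1}preS -cats1 tau_cat.
have [s ->] : exists s, tau [:: trib n.+1] = La :: s by case: trib; eexists.
rewrite -cat_rcons => /esym/pre_prefix; rewrite size_rcons => e.
exact/esym.
Qed.

Lemma trib_thetaS n : trib (theta n).+1 = La.
Proof. by have := pre_thetaS n; rewrite preS /Phi => /rcons_inj[]. Qed.

Lemma leq_theta n : n <= theta n.
Proof.
by elim: n => // n IH; rewrite thetaS -addn1 leq_add //; case: trib.
Qed.

Lemma trib_La x : 0 < x -> trib x = La -> exists q, x = (theta q).+1.
Proof.
case: x => // x _ e; have le_x := leq_theta x.+1.
have : pre (theta x.+1) = pre x ++ La :: drop x.+1 (pre (theta x.+1)).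
  by rewrite -cat_rcons -e -preS -(take_subword1 trib le_x) cat_take_drop.
rewrite -tau_pre => /tau_cut[w1 [w2 [/pre_prefix-> + _]]].
by rewrite tau_pre => /pre_inj->; eexists.
Qed.

Lemma sparse_pre n : sparse (pre n).
Proof.
have le_n : n <= (theta n).+1 by rewrite leqW ?leq_theta.
by rewrite -(take_subword1 trib le_n) pre_thetaS; apply/take_sorted/sparse_Phi.
Qed.

(** A cut before the first letter of [tau v] reduces this to [tau_inj]; an empty [v] offers no [La]
    to cut at and is treated apart. *)
Lemma suffix_Phi v w : suffix (Phi v) (Phi w) = suffix v w.
Proof.
apply/suffixP/suffixP => -[s]; last by move=> ->; exists (tau s); rewrite Phi_cat.
rewrite /Phi -rcons_cat => /rcons_inj[].
case: v => [|x v]; first by exists w; rewrite cats0.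
have [y ey] : exists y, tau (x :: v) = La :: y by case: x; eexists.
rewrite ey => /tau_cut[w1 [w2 [-> _]]]; rewrite -ey => /tau_inj->.
by exists w1.
Qed.

Lemma occurs_at_Phi v q : occurs_at (Phi v) (theta q).+1 = occurs_at v q.
Proof. by rewrite !occurs_atE pre_thetaS suffix_Phi. Qed.

Lemma occurs_at_rcons w x q :
  occurs_at (rcons w x) q -> [/\ 0 < q, trib q = x & occurs_at w q.-1].
Proof.
rewrite !occurs_atE; case: q => [|q].
  by case/suffixP => s; rewrite -rcons_cat; case: (s ++ w).
case/suffixP => s; rewrite preS -rcons_cat => /rcons_inj[e ->].
by split=> //; rewrite /= e suffix_suffix.
Qed.

Lemma occurs_at0 w : w != [::] -> occurs_at w 0 = false.
Proof. by case: w => // x w _; rewrite /occurs_at. Qed.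

Lemma occurs_at_last w q x : w != [::] -> occurs_at w q -> last x w = trib q.
Proof.
case/lastP: w => // w y _ /occurs_at_rcons[_ <- _].
by rewrite last_rcons.
Qed.

Lemma occurs_at_LaP w x :
  w != [::] -> last La w = La -> occurs_at w x -> exists q, x = (theta q).+1.
Proof.
move=> w0 lw wx; apply: trib_La; last by rewrite -(occurs_at_last _ _ La w0 wx).
by case: x wx => //; rewrite occurs_at0.
Qed.

Lemma last_Phi x v : last x (Phi v) = La.
Proof. by rewrite last_rcons. Qed.

Lemma Phi_nonempty v : Phi v != [::].
Proof. by rewrite /Phi; case: tau. Qed.

(** * Counting occurrences through [Phi] *)

Lemma count_iotaS (P : pred nat) m n :
  count P (iota m n.+1) = count P (iota m n) + P (m + n).
Proof. by rewrite -[n.+1]addn1 iotaD count_cat /= addn0. Qed.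

Lemma thetaS_Lc q : trib q.+1 = Lc -> theta q.+1 = (theta q).+1.
Proof. by move=> t; rewrite thetaS t addn1. Qed.

Lemma thetaS_nonLc q : trib q.+1 <> Lc -> theta q.+1 = (theta q).+2.
Proof. by rewrite thetaS; case: trib => // _; rewrite addn2. Qed.

Lemma trib_theta x : 0 < x -> trib x <> Lc ->
  trib (theta x) = if trib x == La then Lb else Lc.
Proof.
case: x => // x _ t; have := tau_pre x.+1.
rewrite thetaS_nonLc // {1}preS -cats1 tau_cat !preS.
by case: (trib x.+1) t => // _; rewrite /= -cat_rcons cats1 => /rcons_inj[].
Qed.

(** [Phi v] cannot end on the second letter of a block, and all other positions are of the form
    [(theta q).+1]. The right side counts from 0 because an empty [v] occurs at 0, which yields the
    first [La]. *)
Lemma count_occurs_Phi v q :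
  count (occurs_at (Phi v)) (iota 1 (theta q).+1) = count (occurs_at v) (iota 0 q.+1).
Proof.
elim: q => [|q IH].
  by have := occurs_at_Phi v 0; rewrite theta0 /= => ->.
rewrite count_iotaS add1n occurs_at_Phi (count_iotaS _ 0 q.+1); congr (_ + _).
rewrite -IH; have [t|/eqP t] := eqVneq (trib q.+1) Lc; first by rewrite thetaS_Lc.
rewrite thetaS_nonLc // count_iotaS add1n [occurs_at _ _]negbTE ?addn0 //.
apply/negP => /(occurs_at_last _ _ La (Phi_nonempty v)).
by rewrite last_Phi -thetaS_nonLc // trib_theta //; case: eqP.
Qed.

Lemma pth_occurrence_Phi v p q : v != [::] ->
  pth_occurrence (Phi v) p (theta q).+1 <-> pth_occurrence v p q.
Proof.
by move=> v0; rewrite /pth_occurrence occurs_at_Phi count_occurs_Phi /= occurs_at0.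
Qed.

Lemma pth_occurrence_La p : pth_occurrence [:: La] p.+1 (theta p).+1.
Proof.
have nil_at q : occurs_at [::] q by rewrite occurs_atE suffix0s.
split; first by rewrite (occurs_at_Phi [::]).
rewrite (count_occurs_Phi [::]) -[RHS](size_iota 0) -count_predT.
exact: eq_count.
Qed.

Lemma pth_occurrence_inj w p q q' : w != [::] ->
  pth_occurrence w p q -> pth_occurrence w p q' -> q = q'.
Proof.
have ltq n n' : n < n' -> occurs_at w n' ->
    count (occurs_at w) (iota 1 n) < count (occurs_at w) (iota 1 n').
  case: n' => // n' le_n occ; rewrite count_iotaS add1n occ addn1 ltnS.
  by rewrite -(subnKC (le_n : n <= n')) iotaD count_cat leq_addr.
move=> w0 [o <-] [o' e]; case: (ltngtP q q') => // /ltq; rewrite e ltnn.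
  by move/(_ o').
by move/(_ o).
Qed.

Lemma occ_endE w p q : w != [::] -> pth_occurrence w p q -> occ_end w p = q.
Proof.
move=> w0 pq; apply: xget_subset1 => // x y.
exact: pth_occurrence_inj.
Qed.

(** * Capping a word by [La] on both sides *)

Section Core.

Variable w : word.
Hypotheses (w0 : w != [::]) (hw : head La w <> La) (lw : last La w <> La).

(** By sparsity both neighbours of [w] are [La]; a left neighbour exists because the Tribonacci word
    itself begins with [La]. *)
Lemma occurs_at_core q : occurs_at (La :: rcons w La) q.+1 = occurs_at w q.
Proof.
rewrite -rcons_cons; apply/idP/idP => [/occurs_at_rcons[_ _]|].
  by rewrite !occurs_atE -cat1s; apply: catl_suffix.
rewrite !occurs_atE preS => /suffixP[s e].
have tq : trib q.+1 = La.
  have := sparse_pre q.+1; rewrite preS e; move: lw w0; case/lastP: (w) => // w' y.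
  rewrite last_rcons -!cats1 -!catA => ny _ /= h.
  by move: h; rewrite catA => /sparse_nonA; apply.
rewrite tq; case/lastP: s e => [|s z] e.
  by case: hw; rewrite -[w]/([::] ++ w) -e; case: q {tq e}.
have ez : z = La.
  have := sparse_pre q; rewrite e; move: hw w0; case: (w) => // y w' /= ny _.
  rewrite cat_rcons; case: z {e} => // /sparse_nonA h; case: ny; exact: h.
by rewrite e ez cat_rcons rcons_cat suffix_suffix.
Qed.

Lemma pth_occurrence_core p q :
  pth_occurrence (La :: rcons w La) p q.+1 <-> pth_occurrence w p q.
Proof.
rewrite /pth_occurrence occurs_at_core; suff -> :
  count (occurs_at (La :: rcons w La)) (iota 1 q.+1) = count (occurs_at w) (iota 1 q).
  by [].
elim: q => [|q IH]; first by rewrite count_iotaS add1n occurs_at_core occurs_at0.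
by rewrite count_iotaS IH add1n occurs_at_core count_iotaS.
Qed.

End Core.

(** * Structure of the kernel words *)

(* kernel_tail i is T_(i-3) T_(i-6) T_(i-9)..., that is K_(i+1) without its first
   letter. *)
Fixpoint kernel_tail (i : nat) : word :=
  if i is j.+3 then Tw j ++ kernel_tail j else [::].

Lemma nat_ind3 (P : nat -> Prop) :
  P 0 -> P 1 -> P 2 -> (forall n, P n -> P n.+3) -> forall n, P n.
Proof.
move=> P0 P1 P2 PS n; suff [] : [/\ P n, P n.+1 & P n.+2] by [].
by elim: n => // n [] *; split=> //; apply: PS.
Qed.

Lemma TwS3 n : Tw n.+3 = Tw n.+2 ++ Tw n.+1 ++ Tw n.
Proof.
elim: n => // n IH.
by rewrite -[LHS]/(tau (Tw n.+3)) [in LHS]IH !tau_cat.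
Qed.

(** In terms of kernel numbers, k_(i+3) + k_(i+2) = |T_i| + 1, which turns the recursion for k_m
    into that of the tails. *)
Lemma size_kernel_tail i :
  size (kernel_tail i.+2) + size (kernel_tail i.+1) + 1 = size (Tw i).
Proof.
elim/nat_ind3: i => // i IH.
rewrite -[kernel_tail i.+4.+1]/(Tw i.+2 ++ kernel_tail i.+2).
rewrite -[kernel_tail i.+4]/(Tw i.+1 ++ kernel_tail i.+1) TwS3 !size_cat -IH; lia.
Qed.

Lemma kernel_numE i : kernel_num i.+1 = (size (kernel_tail i)).+1.
Proof.
suff [] : [/\ kernel_num i.+1 = (size (kernel_tail i)).+1,
  kernel_num i.+2 = (size (kernel_tail i.+1)).+1 &
  kernel_num i.+3 = (size (kernel_tail i.+2)).+1] by [].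
elim: i => // i [e1 e2 e3]; split=> //.
rewrite -[LHS]/(kernel_num i.+3 + kernel_num i.+2 + kernel_num i.+1 - 1).
by rewrite e1 e2 e3 [in RHS]/= size_cat -size_kernel_tail; lia.
Qed.

(** Evaluates the [take] in K_m. After the first factor, [TwS3] leaves the claim three steps lower,
    as [Tw i.+1] is a prefix of [Tw i.+2]. *)
Lemma kernel_tail_prefix i : prefix (kernel_tail i.+3) (Tw i.+1).
Proof.
elim/nat_ind3: i => // i IH.
rewrite -[kernel_tail _]/(Tw i.+3 ++ kernel_tail i.+3) (TwS3 i.+1) prefix_catr //.
rewrite eqxx; apply: (prefix_trans IH); have [v _ ->] := Tw_prefixS i.+1.
by rewrite -catA prefix_prefix.
Qed.

Definition next_letter (x : letter) : letter :=
  match x with La => Lb | Lb => Lc | Lc => La end.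

Lemma deltaS n : delta n.+1 = next_letter (delta n).
Proof.
rewrite /delta -[Tw n.+1]/(tau (Tw n)).
have := size_Tw n; case/lastP: (Tw n) => // w x _.
by rewrite -cats1 tau_cat !last_cat; case: x.
Qed.

Lemma kernel_wordE i : kernel_word i.+1 = delta i :: kernel_tail i.
Proof.
case: i => [|[|[|i]]] //.
rewrite -[LHS]/(delta (i.+4 - 1) :: take (kernel_num i.+4 - 1) (Tw (i.+4 - 3))).
rewrite kernel_numE !subn1 subSS !subSS subn0; congr (_ :: _).
by have /prefixP[s ->] := kernel_tail_prefix i; rewrite take_size_cat.
Qed.

(** [tau] turns each factor T_j of the tail into T_(j+1). The closing [La] of [Phi] is a new factor
    T_0, present when i is 2 modulo 3, that is, when [delta i] is [Lc]. *)
Lemma tau_kernel_tail i :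
  kernel_tail i.+1 = if delta i == Lc then Phi (kernel_tail i) else tau (kernel_tail i).
Proof.
elim/nat_ind3: i => // i IH.
have -> : delta i.+3 = delta i by rewrite !deltaS; case: delta.
rewrite -[LHS]/(Tw i.+1 ++ kernel_tail i.+1) IH /= Phi_cat tau_cat.
by case: ifP.
Qed.

Lemma Phi_kernel_Lc i :
  delta i = Lc -> Phi (kernel_word i.+1) = kernel_word i.+2.
Proof. by move=> d; rewrite !kernel_wordE tau_kernel_tail deltaS d Phi_cons. Qed.

Lemma Phi_kernel_nonLc i : delta i <> Lc ->
  Phi (kernel_word i.+1) = La :: rcons (kernel_word i.+2) La.
Proof.
by rewrite !kernel_wordE tau_kernel_tail deltaS Phi_cons; case: delta.
Qed.

Lemma rev_kernel_word i : rev (kernel_word i) = kernel_word i.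
Proof.
case: i => //; elim=> // i IH; have := rev_Phi (kernel_word i.+1); rewrite IH.
have [/Phi_kernel_Lc->//|/eqP/Phi_kernel_nonLc->] := eqVneq (delta i) Lc.
by rewrite rev_cons rev_rcons rcons_cons => -[/rcons_inj[]].
Qed.

(** Needed because [Ker w] is a word, not an index. Equal first letters mean that both words come
    from their predecessors by the same rule, so [Phi_inj] descends. *)
Lemma kernel_word_inj i j : kernel_word i.+1 = kernel_word j.+1 -> i = j.
Proof.
elim: i j => [|i IH] [|j] // e.
- have := Phi_nonempty (kernel_word j.+1).
  have [d|/eqP d] := eqVneq (delta j) Lc.
    have := Phi_kernel_Lc _ d; rewrite -e kernel_wordE d Phi_cons.
    by case: (Phi_head (kernel_tail j)) => s ->.
  by move: e; rewrite [RHS]kernel_wordE deltaS; case: delta d.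
- have [d|/eqP d] := eqVneq (delta i) Lc.
    have := Phi_kernel_Lc _ d; rewrite e kernel_wordE d Phi_cons.
    by case: (Phi_head (kernel_tail i)) => s ->.
  by move: e; rewrite [LHS]kernel_wordE deltaS; case: delta d.
- congr _.+1; apply: IH; apply: Phi_inj.
  have: delta i = delta j.
    by move: (congr1 (head La) e); rewrite !kernel_wordE !deltaS /=; do 2 case: delta.
  have [d d'|/eqP d d'] := eqVneq (delta i) Lc.
    by rewrite !Phi_kernel_Lc -?d' // e.
  by rewrite !Phi_kernel_nonLc -?d' // e.
Qed.

(** Bounds the indices of kernel words inside a given word, so that a largest one exists. *)
Lemma size_kernel_word i : i <= size (kernel_word i) + 2.
Proof.
case: i => [|[|[|[|i]]]] //.
rewrite kernel_wordE /= size_cat; have := size_Tw i; lia.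
Qed.

(** * The kernel index as a relation *)

Definition is_kernel (w : word) (m : nat) : Prop :=
  [/\ 1 <= m, infix (kernel_word m) w &
    forall j, 1 <= j -> infix (kernel_word j) w -> j <= m].

Lemma is_kernel_inj w m n : is_kernel w m -> is_kernel w n -> m = n.
Proof.
move=> [m1 im mP] [n1 i_n nP]; apply/eqP; rewrite eqn_leq.
by rewrite mP // nP.
Qed.

Lemma KerE w m : w != [::] -> 0 < m -> Ker w = kernel_word m <-> is_kernel w m.
Proof.
move=> w0 m0; split=> [e|km]; last first.
  congr kernel_word; apply: xget_subset1 => // x y; exact: is_kernel_inj.
have [n kn] : exists n, is_kernel w n.
  pose P j := (0 < j) && infix (kernel_word j) w.
  have exP : exists j, P j.
    (* K_1, K_2 and K_3 are the single letters, so the first letter of [w] is a kernel word. *)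
    case: w w0 {e} @P => // x w _ P; exists (match x with La => 1 | Lb => 2 | Lc => 3 end).
    by case: x @P => P; apply/infixP; exists [::], w.
  have ubP j : P j -> j <= size w + 2.
    by case/andP => _ /size_infix h; rewrite (leq_trans (size_kernel_word j)) ?leq_add2r.
  case: (ex_maxnP exP ubP) => n /andP[n0 nw] nP; exists n; split=> // j j0 jw.
  by apply: nP; rewrite /P j0.
have := xgetPex 0 (ex_intro _ n kn : exists n, [set m | is_kernel w m] n).
rewrite -/(Ker w); move: e; rewrite /Ker -/(is_kernel w) /=.
set x := xget _ _; case: x => [|x]; first by move=> _ [].
by case: m m0 => // m _ /kernel_word_inj->.
Qed.

(** * Kernel words under [Phi] and capping *)

(** The last [La] of an occurrence of [Phi u] either ends [Phi v] or opens a block; cutting there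
    makes the occurrence a suffix, and [suffix_Phi] applies. *)
Lemma infix_Phi u v : infix (Phi u) (Phi v) = infix u v.
Proof.
apply/infixP/infixP => -[x [y e]]; last first.
  have [z ez] := Phi_head y.
  by exists (tau x), z; rewrite e !Phi_cat ez /Phi cat_rcons.
case/lastP: y e => [|y z].
  rewrite cats0 => e; have : suffix (Phi u) (Phi v) by rewrite e suffix_suffix.
  by rewrite suffix_Phi => /suffixP[s ->]; exists s, [::]; rewrite cats0.
rewrite -!rcons_cat => /rcons_inj[].
rewrite /Phi cat_rcons catA => /tau_cut[v1 [v2 [-> e _]]] _.
have : suffix (Phi u) (Phi v1) by rewrite /Phi -e rcons_cat suffix_suffix.
by rewrite suffix_Phi => /suffixP[s ->]; exists s, v2; rewrite catA.
Qed.

Lemma infix_cap (u w : word) x y :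
  ~~ prefix u (x :: rcons w y) -> ~~ suffix u (x :: rcons w y) ->
  infix u (x :: rcons w y) = infix u w.
Proof.
move=> np ns; apply/idP/idP => [|/infixP[s [t ->]]]; last first.
  by apply/infixP; exists (x :: s), (rcons t y); rewrite /= !rcons_cat.
case/infixP => -[|x' s] [t e]; first by rewrite e prefix_prefix in np.
case/lastP: t e => [|t y'] e; first by rewrite e cats0 suffix_suffix in ns.
move: e; rewrite -!rcons_cat => -[_ /rcons_inj[-> _]].
by apply/infixP; exists s, t.
Qed.

Lemma kernel_word_head i : 0 < i -> exists s,
  kernel_word i.+1 = Lb :: s \/ kernel_word i.+1 = Lc :: s \/
  kernel_word i.+1 = [:: La, La & s].
Proof.
case: i => // i _; case d: (delta i).
- by rewrite kernel_wordE deltaS d; eexists; left.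
- by rewrite kernel_wordE deltaS d; eexists; right; left.
rewrite -Phi_kernel_Lc // kernel_wordE d Phi_cons.
by have [s ->] := Phi_head (kernel_tail i); exists s; right; right.
Qed.

Lemma rev_core w : rev w = w -> rev (La :: rcons w La) = La :: rcons w La.
Proof. by move=> rw; rewrite rev_cons rev_rcons rw. Qed.

(** A new occurrence would use an added end letter: [kernel_word_head] excludes the left end,
    reversal the right one. *)
Lemma infix_kernel_core i w :
  0 < i -> rev w = w -> w != [::] -> head La w <> La ->
  infix (kernel_word i.+1) (La :: rcons w La) = infix (kernel_word i.+1) w.
Proof.
move=> i0 rw w0 hw.
have np : ~~ prefix (kernel_word i.+1) (La :: rcons w La).
  case: w hw w0 {rw} => // x w hx _.
  by have [s [->|[->|->]]] := kernel_word_head _ i0 => //=; case: x hx.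
by rewrite infix_cap // -rev_kernel_word -rev_core // suffix_rev.
Qed.

(** As [z] is sparse with [La] at both ends, every occurrence of [u] in it lies between two [La].
    The defaults [Lb] force [z] to be nonempty. *)
Lemma infix_nonA u z :
  u != [::] -> head La u <> La -> last La u <> La ->
  sparse z -> head Lb z = La -> last Lb z = La ->
  infix (La :: rcons u La) z = infix u z.
Proof.
move=> u0 hu lu sz hz lz; apply/infixP/infixP => -[s [t e]].
  by exists (rcons s La), (La :: t); rewrite e /= !cat_rcons.
have [s' es] : exists s', s = rcons s' La.
  case: u u0 hu {lu} e => // x u _ /= hu e; case/lastP: s e => [|s y] e.
    by case: hu; rewrite e in hz.
  exists s; congr rcons; move: sz; rewrite e cat_rcons.
  by case: y {e} => // /sparse_nonA h; case: hu; apply: h.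
have [t' et] : exists t', t = La :: t'.
  case/lastP: u u0 lu e {hu} => // u x _; rewrite last_rcons => lu e.
  case: t e => [|y t] e.
    by case: lu; move: lz; rewrite e cats0 last_cat last_rcons.
  exists t; congr (_ :: _); move: sz; rewrite e cat_rcons catA => /sparse_nonA.
  exact.
by exists s', t'; rewrite e es et /= !cat_rcons.
Qed.

Lemma head_Phi x v : head x (Phi v) = La.
Proof. by have [s ->] := Phi_head v. Qed.

Lemma last_kernel_word x i : last x (kernel_word i.+1) = head x (kernel_word i.+1).
Proof.
by rewrite -{1}rev_kernel_word kernel_wordE rev_cons last_rcons.
Qed.

(** If [Phi] of a kernel word is the next one capped, [infix_nonA] shows that the caps do not affect
    occurrence in [Phi v]. *)
Lemma infix_kernel_Phi i v :
  infix (kernel_word i.+2) (Phi v) = infix (kernel_word i.+1) v.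
Proof.
have [d|/eqP d] := eqVneq (delta i) Lc; first by rewrite -Phi_kernel_Lc // infix_Phi.
have hK : head La (kernel_word i.+2) <> La.
  by rewrite kernel_wordE deltaS; case: delta d.
rewrite -[RHS]infix_Phi Phi_kernel_nonLc // infix_nonA //.
- by rewrite kernel_wordE.
- by rewrite last_kernel_word.
- exact: sparse_Phi.
- exact: head_Phi.
- exact: last_Phi.
Qed.

Lemma is_kernel_Phi v m : 0 < m -> is_kernel (Phi v) m.+1 <-> is_kernel v m.
Proof.
case: m => // m _; split=> -[_ im mP]; split=> //.
- by rewrite -infix_kernel_Phi.
- by case=> // j _; rewrite -infix_kernel_Phi => /mP; apply.
- by rewrite infix_kernel_Phi.
- by case=> // -[|j] // _; rewrite infix_kernel_Phi => /mP; apply.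
Qed.

(** The caps can create no kernel word but K_1, whose index is below [m]. *)
Lemma is_kernel_core w m : 1 < m -> rev w = w -> w != [::] -> head La w <> La ->
  is_kernel (La :: rcons w La) m <-> is_kernel w m.
Proof.
case: m => // -[|m] // _ rw w0 hw.
split=> -[_ im mP]; split=> //.
- by rewrite -infix_kernel_core.
- by case=> // -[|j] // _; rewrite -infix_kernel_core // => /mP; apply.
- by rewrite infix_kernel_core.
- by case=> // -[|j] // _; rewrite infix_kernel_core // => /mP; apply.
Qed.

(** Any other nonempty word contains b, c or aa, which are K_2, K_3 and K_4. *)
Lemma is_kernel1 w : w != [::] -> is_kernel w 1 <-> w = [:: La].
Proof.
move=> w0; split=> [[_ _ mP]|->]; last first.
  split=> // -[|[|j]] // _.
  by have [s [->|[->|->]]] := kernel_word_head _ (ltn0Sn j).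
have nK i s t : 1 < i -> w <> s ++ kernel_word i ++ t.
  move=> i1 e; suff: i <= 1 by rewrite leqNgt i1.
  by apply: mP; [apply: ltnW | apply/infixP; exists s, t].
case: w w0 {mP} nK => [|[] w] // _ nK; first last.
- by case: (nK 3 [::] w).
- by case: (nK 2 [::] w).
case: w nK => [|[] w] // nK.
- by case: (nK 4 [::] w).
- by case: (nK 2 [:: La] w).
- by case: (nK 3 [:: La] w).
Qed.

(** * Generating palindromes from those of lower kernel index *)

(** An occurrence of [w] ends some prefix [Phi (pre q)]; cutting that image before the first [La] of
    [w] leaves the required [Phi v]. *)
Lemma Phi_decode w : w <> [::] -> head Lb w = La -> last Lb w = La -> factor w ->
  exists v, w = Phi v.
Proof.
move=> w0 hw lw [x wx]; have wn0 : w != [::] by apply/eqP.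
have lw' : last La w = La by case: (w) w0 lw.
have [q eq] := occurs_at_LaP _ _ wn0 lw' wx.
move: wx; rewrite occurs_atE eq pre_thetaS => /suffixP[s].
case/lastP: w {w0 wn0 lw'} hw lw => [//|w y]; rewrite last_rcons => hw ->.
rewrite -rcons_cat => /rcons_inj[].
case: w hw => [|z w] /= hw; first by exists [::].
by rewrite hw => /tau_cut[w1 [w2 [_ _ e]]]; exists w2; rewrite /Phi -e.
Qed.

Lemma factor_Phi v : factor (Phi v) <-> factor v.
Proof.
split=> -[q]; last by rewrite -occurs_at_Phi; exists (theta q).+1.
move=> vq; have [|x e] := occurs_at_LaP _ _ (Phi_nonempty v) _ vq; first exact: last_Phi.
by exists x; rewrite -occurs_at_Phi -e.
Qed.

Lemma head_last_pal w (x : letter) : rev w = w -> head x w = last x w.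
Proof. by case: w => // y w /(congr1 (last x)) /= <-; rewrite rev_cons last_rcons. Qed.

Lemma factor_core w : w != [::] -> rev w = w -> head La w <> La ->
  factor (La :: rcons w La) <-> factor w.
Proof.
move=> w0 rw hw; have lw : last La w <> La by rewrite -head_last_pal.
split=> -[q]; last by rewrite -occurs_at_core //; exists q.+1.
by case: q => [|q]; [rewrite occurs_at0 | rewrite occurs_at_core //; exists q].
Qed.

(** If [v] began with [Lc], its image would begin with aa, and stripping would leave an empty word
    or one beginning with [La]. *)
Lemma Phi_core v : rev v = v -> v != [::] -> last La v <> Lc ->
  exists w, [/\ La :: rcons w La = Phi v, rev w = w, w != [::] & head La w <> La].
Proof.
move=> rv v0 lv; have hv : head La v <> Lc by rewrite head_last_pal.
have [w [e w0 hw]] :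
    exists w, [/\ La :: rcons w La = Phi v, w != [::] & head La w <> La].
  case: v {rv lv} v0 hv => [|[] v] // _ _.
  - by exists (Lb :: tau v); rewrite Phi_cons.
  - by exists (Lc :: tau v); rewrite Phi_cons.
exists w; split=> //; move: (rev_Phi v); rewrite rv -e.
by rewrite rev_cons rev_rcons rcons_cons => -[/rcons_inj[]].
Qed.

(** A palindrome beginning with [La] is decoded directly, any other one after capping. Conversely,
    [Phi_core] allows the image to be stripped when [v] does not end with [Lc]. *)
Lemma pal_kernel_S w m : 0 < m ->
  pal_factors w /\ is_kernel w m.+1 <->
  exists v, [/\ pal_factors v, is_kernel v m &
    w = Phi v \/ [/\ last La v <> Lc, head La w <> La & La :: rcons w La = Phi v]].
Proof.
move=> m0; split.
  move=> [[w0 rw fw] kw].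
  have [hw|hw] := pselect (head Lb w = La).
    have lw : last Lb w = La by rewrite -head_last_pal.
    have [v e] := Phi_decode _ w0 hw lw fw.
    exists v; split; last by left.
      split; last by apply/factor_Phi; rewrite -e.
        move=> v0; have : is_kernel w 1 by apply/is_kernel1; rewrite e v0.
        by move/(is_kernel_inj _ _ _ kw) => -[m00]; rewrite m00 in m0.
      by apply: Phi_inj; rewrite -rev_Phi -e.
    by rewrite e in kw; apply/is_kernel_Phi.
  have wn0 : w != [::] by apply/eqP.
  have hw' : head La w <> La by case: (w) hw w0.
  have fw' : factor (La :: rcons w La) by apply/factor_core.
  have [v e] : exists v, La :: rcons w La = Phi v.
    by apply: Phi_decode => //; rewrite -rcons_cons last_rcons.
  have v0 : v <> [::] by move=> v0; rewrite v0 in e; case: (w) w0 e => // ? [].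
  have rv : rev v = v by apply: Phi_inj; rewrite -rev_Phi -e rev_core.
  exists v; split.
  - by split=> //; apply/factor_Phi; rewrite -e.
  - by apply/is_kernel_Phi => //; rewrite -e is_kernel_core.
  - right; split=> //; rewrite -head_last_pal //.
    move: e hw' wn0; case: (v) v0 => // -[] v' _ //; rewrite Phi_cons.
    have [s ->] := Phi_head v'; case: (w) => // x w' [<- _] h _.
    by case: h.
move=> [v [[v0 rv fv] kv [->|[lv hw e]]]].
  split; last by apply/is_kernel_Phi.
  split; [exact/eqP/Phi_nonempty | by rewrite rev_Phi rv | exact/factor_Phi].
have [w' [e' rw w0 _]] := Phi_core _ rv (introN eqP v0) lv.
move: e' rw w0; rewrite -e => -[/rcons_inj[->]] rw w0.
split; last by apply/is_kernel_core => //; rewrite e; apply/is_kernel_Phi.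
by split=> //; [exact/eqP | apply/factor_core => //; rewrite e; apply/factor_Phi].
Qed.

(** * Lifting sets of positions *)

(** The two parts are the end positions of [Phi v] and of its stripped form. The last letter of [v]
    is read off as [trib x], so only positions matter. *)
Definition lift_pos (S : set nat) : set nat :=
  [set (theta x).+1 | x in S] `|` [set theta x | x in S `&` [set x | trib x <> Lc]].

Lemma lift_posU S S' : lift_pos (S `|` S') = lift_pos S `|` lift_pos S'.
Proof.
rewrite /lift_pos image_setU setUACA; congr (_ `|` _).
rewrite -image_setU; by rewrite setIUl.
Qed.

Definition pal_positions (m p : nat) : set nat :=
  [set q | exists w, [/\ pal_factors w, is_kernel w m & pth_occurrence w p q]].

Lemma pal_positions1 p : pal_positions 1 p.+1 = [set (theta p).+1].
Proof.
have pfa : factor [:: La].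
  by exists (theta p).+1; case: (pth_occurrence_La p).
apply/seteqP; split=> [q [w [[w0 _ _] /is_kernel1 ew]]|q ->] /=.
  rewrite ew; last exact/eqP.
  move/pth_occurrence_inj; apply=> //; exact: pth_occurrence_La.
exists [:: La]; split=> //; [exact/is_kernel1 | exact: pth_occurrence_La].
Qed.

Lemma pal_positionsS m p : 0 < m ->
  pal_positions m.+1 p = lift_pos (pal_positions m p).
Proof.
move=> m0; apply/seteqP; split=> q.
  move=> [w [pw kw pq]]; have [v [pv kv]] := (pal_kernel_S w m m0).1 (conj pw kw).
  have v0 : v != [::] by case: pv => /eqP.
  case=> [e|[lv hw e]].
    have oq : occurs_at (Phi v) q by rewrite -e; case: pq.
    have [x ex] := occurs_at_LaP _ _ (Phi_nonempty v) (last_Phi _ _) oq.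
    left; exists x => //; exists v; split=> //.
    by apply/pth_occurrence_Phi; rewrite // -e -ex.
  have [[/eqP w0 rw _] lw] : pal_factors w /\ last La w <> La.
    by split=> //; rewrite -head_last_pal //; case: pw.
  (* The capped word ends one position after [w], so [q.+1] is [(theta x).+1]. *)
  have pq' : pth_occurrence (Phi v) p q.+1 by rewrite -e; apply/pth_occurrence_core.
  have [x [ex]] := occurs_at_LaP _ _ (Phi_nonempty v) (last_Phi _ _) pq'.1.
  rewrite ex in pq'; move/pth_occurrence_Phi: pq' => /(_ v0) pq'.
  right; exists x; last by [].
  split; first by exists v.
  by rewrite /= -(occurs_at_last _ _ La v0 pq'.1).
case=> [[x [v [pv kv px]] <-]|[x [[v [pv kv px]] tx] <-]];
    have v0 : v != [::] by case: pv => /eqP.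
  have [pw kw] : pal_factors (Phi v) /\ is_kernel (Phi v) m.+1.
    by apply/pal_kernel_S => //; exists v; split=> //; left.
  by exists (Phi v); split=> //; apply/pth_occurrence_Phi.
have lv : last La v <> Lc by rewrite (occurs_at_last _ _ La v0 px.1).
have [w [e rw w0 hw]] : exists w,
    [/\ La :: rcons w La = Phi v, rev w = w, w != [::] & head La w <> La].
  by apply: Phi_core => //; case: pv.
have [pw kw] : pal_factors w /\ is_kernel w m.+1.
  by apply/pal_kernel_S => //; exists v; split=> //; right.
exists w; split=> //; apply/pth_occurrence_core; rewrite -?head_last_pal //.
by rewrite e; apply/pth_occurrence_Phi.
Qed.

(** Induction on the kernel index, starting from [[:: La]]; it keeps the default 0 of [occ_end] out
    of [bracketE]. *)
Lemma pth_occurrence_ex m w p : pal_factors w -> is_kernel w m.+1 ->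
  exists q, pth_occurrence w p.+1 q.
Proof.
elim: m w => [|m IH] w pw kw.
  have w0 : w != [::] by case: pw => /eqP.
  rewrite ((is_kernel1 w w0).1 kw).
  by exists (theta p).+1; apply: pth_occurrence_La.
have [v [pv kv]] := (pal_kernel_S w m.+1 isT).1 (conj pw kw).
have v0 : v != [::] by case: pv => /eqP.
have [q pq] := IH v pv kv.
have pq' : pth_occurrence (Phi v) p.+1 (theta q).+1 by apply/pth_occurrence_Phi.
case=> [->|[lv hw e]]; first by exists (theta q).+1.
exists (theta q); case: pw => /eqP w0 rw _; apply/pth_occurrence_core => //.
  by rewrite -head_last_pal.
by rewrite e.
Qed.

Lemma bracketE m p : 0 < m -> bracket m p.+1 = pal_positions m p.+1.
Proof.
case: m => // m _; apply/seteqP; split=> q.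
  move=> [w [pw kw] <-]; have w0 : w != [::] by case: pw => /eqP.
  have kw' := (KerE w m.+1 w0 isT).1 kw.
  have [x px] := pth_occurrence_ex _ _ p pw kw'.
  by exists w; split=> //; rewrite (occ_endE _ _ _ w0 px).
move=> [w [pw kw pq]]; have w0 : w != [::] by case: pw => /eqP.
exists w; last exact: occ_endE.
by split=> //; apply/KerE.
Qed.

Lemma lift_pos1_Lc x : trib x = Lc -> lift_pos [set x] = [set (theta x).+1].
Proof.
move=> tx; rewrite /lift_pos image_set1 (_ : _ `&` _ = set0) ?image_set0 ?setU0 //.
by apply/seteqP; split=> y //= [->].
Qed.

Lemma lift_pos1_nonLc x :
  trib x <> Lc -> lift_pos [set x] = [set theta x] `|` [set (theta x).+1].
Proof.
move=> tx; rewrite /lift_pos image_set1 setUC (_ : _ `&` _ = [set x]) ?image_set1 //.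
by apply/seteqP; split=> y //= [] // ->.
Qed.

Lemma theta_gt0 x : 0 < x -> 0 < theta x.
Proof. by move=> x0; apply: leq_trans (leq_theta x). Qed.

Theorem mainTheorem8 (m p : nat) (hm : 4 <= m) (hp : 1 <= p) :
  bracket m p =
    bracket (m - 3) (occ_end [:: Lc] p + 1)
    `|` bracket (m - 2) (occ_end [:: Lb] p + 1)
    `|` bracket (m - 1) (occ_end [:: La] p + 1).
Proof.
case: p hp => // p _; set A := (theta p).+1.
have pA : pth_occurrence [:: La] p.+1 A := pth_occurrence_La p.
(* Capped, b and c become aba and aca, the images under [Phi] of a and b. *)
have pB : pth_occurrence [:: Lb] p.+1 (theta A).
  by apply/pth_occurrence_core => //; apply/(pth_occurrence_Phi [:: La]).
have pC : pth_occurrence [:: Lc] p.+1 (theta (theta A)).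
  by apply/pth_occurrence_core => //; apply/(pth_occurrence_Phi [:: Lb]).
rewrite !(occ_endE _ _ _ _ pA, occ_endE _ _ _ _ pB, occ_endE _ _ _ _ pC) //.
rewrite !addn1 !bracketE; try lia.
have tA : trib A = La := trib_thetaS p.
have tB : trib (theta A) = Lb by rewrite trib_theta ?tA.
have tC : trib (theta (theta A)) = Lc.
  by rewrite trib_theta ?tB // theta_gt0.
case: m hm => [|[|[|[|m]]]] // _; rewrite !subSS !subn0.
elim: m => [|m IH].
  (* The left side lifts the singleton of [A] three times. The first lifting gives [theta A] and
     [(theta A).+1]; the latter, lifted twice more, is <K_3, A+1>. Lifting [theta A] gives
     [theta (theta A)] and a point whose lifting is <K_2, [theta A] + 1>. Finally [theta (theta A)]
     carries c, so its lifting is a single point, which forms the K_1 set. *)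
  rewrite (pal_positionsS 3) // !(pal_positionsS 2) // !(pal_positionsS 1) // !pal_positions1.
  rewrite (lift_pos1_nonLc A) ?tA // lift_posU (lift_pos1_nonLc (theta A)) ?tB //.
  by rewrite !lift_posU lift_pos1_Lc.
(* Lifting raises all four kernel indices by one and leaves the occurrence numbers fixed. *)
by rewrite pal_positionsS // IH !lift_posU -!pal_positionsS.
Qed.
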